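(* Let $$S_6=\{(1,0,-1,-3),(1,1,-1,-3),(1,2,-1,-3),(1,3,-1,-3),(1,4,-1,-4),(2,0,0,-2),(2,1,0,-2),(2,2,0,-2),(2,3,0,-3),(2,4,0,-3),(1,1,0,-3),(1,2,0,-3),(1,3,0,-3),(1,4,0,-3)\}.$$ If $(t_1,t_2,t_3,t_4)\in S_6$, then for all integers $n\geq 0$, $$a_{1^{t_1}2^{t_2}3^{t_3}4^{t_4}}(4n)>0,\qquad a_{1^{t_1}2^{t_2}3^{t_3}4^{t_4}}(4n+1)<0,$$ $$a_{1^{t_1}2^{t_2}3^{t_3}4^{t_4}}(4n+2)<0,\qquad a_{1^{t_1}2^{t_2}3^{t_3}4^{t_4}}(4n+3)>0.$$
   Context: For $|q|<1$ (or as formal power series in $q$) let $f_j:=(q^j;q^j)_\infty=\prod_{k\ge 1}(1-q^{jk})$ for each positive integer $j$. For a positive integer $m$ and integers $t_1,\dots,t_m$ (possibly zero or negative), the integers $a_{1^{t_1}2^{t_2}\cdots m^{t_m}}(n)$, $n\ge 0$, are defined by $\sum_{n=0}^\infty a_{1^{t_1}2^{t_2}\cdots m^{t_m}}(n)q^n=f_1^{t_1}f_2^{t_2}\cdots f_m^{t_m}$. *)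

(* Defs.v *)
From HB Require Import structures.
From mathcomp Require Import all_boot all_order all_algebra.
From mathcomp Require Import boolp.

Set Implicit Arguments.
Unset Strict Implicit.
Unset Printing Implicit Defensive.

Import Order.TTheory GRing.Theory Num.Theory.
Local Open Scope ring_scope.

(* Formal power series in one variable q, [s = \sum_n (coefs s n) q^n].
   The record (rather than the bare function type) keeps the Cauchy product
   below from competing with the pointwise product of functions.             *)
Record fps (R : Type) := Fps { coefs : nat -> R }.

Lemma fpsP (R : Type) (s t : fps R) : coefs s =1 coefs t <-> s = t.
Proof. by split=> [|-> //]; case: s t => [s] [t] /= /funext ->. Qed.

HB.instance Definition _ (R : Type) := gen_eqMixin (fps R).
HB.instance Definition _ (R : Type) := gen_choiceMixin (fps R).

Section Zmodule.
Variable R : zmodType.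
Implicit Types s t u : fps R.

Definition fps_zero : fps R := Fps (fun=> 0).
Definition fps_opp s : fps R := Fps (fun n => - coefs s n).
Definition fps_add s t : fps R := Fps (fun n => coefs s n + coefs t n).

Fact fps_addA : associative fps_add.
Proof. by move=> s t u; apply/fpsP=> n /=; rewrite addrA. Qed.
Fact fps_addC : commutative fps_add.
Proof. by move=> s t; apply/fpsP=> n /=; rewrite addrC. Qed.
Fact fps_add0 : left_id fps_zero fps_add.
Proof. by move=> s; apply/fpsP=> n /=; rewrite add0r. Qed.
Fact fps_addN : left_inverse fps_zero fps_opp fps_add.
Proof. by move=> s; apply/fpsP=> n /=; rewrite addNr. Qed.

HB.instance Definition _ :=
  GRing.isZmodule.Build (fps R) fps_addA fps_addC fps_add0 fps_addN.

Lemma coefs0 n : coefs (0 : fps R) n = 0. Proof. by []. Qed.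
Lemma coefsN s n : coefs (- s) n = - coefs s n. Proof. by []. Qed.
Lemma coefsD s t n : coefs (s + t) n = coefs s n + coefs t n.
Proof. by []. Qed.

End Zmodule.

Section Ring.
Variable R : comNzRingType.
Implicit Types (s t u : fps R) (p q : {poly R}).

Definition fps_one : fps R := Fps (fun n => (n == 0)%:R).
Definition fps_mul s t : fps R :=
  Fps (fun n => \sum_(i < n.+1) coefs s i * coefs t (n - i)).

Let trunc n s : {poly R} := \poly_(i < n.+1) coefs s i.

Let truncE n s i : (i <= n)%N -> (trunc n s)`_i = coefs s i.
Proof. by move=> le_in; rewrite coef_poly ltnS le_in. Qed.

Let mul_trunc n s t i :
  (i <= n)%N -> coefs (fps_mul s t) i = (trunc n s * trunc n t)`_i.
Proof.
move=> le_in; rewrite coefM; apply: eq_bigr => j _.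
by rewrite !truncE // (leq_trans _ le_in) ?leq_subr // -ltnS.
Qed.

Let coefM_eq p p' q q' n :
    (forall i, (i <= n)%N -> p`_i = p'`_i) ->
    (forall i, (i <= n)%N -> q`_i = q'`_i) ->
  (p * q)`_n = (p' * q')`_n.
Proof.
move=> eq_p eq_q; rewrite !coefM; apply: eq_bigr => i _.
by rewrite eq_p ?eq_q ?leq_subr // -ltnS.
Qed.

Fact fps_mulC : commutative fps_mul.
Proof. by move=> s t; apply/fpsP=> n; rewrite !(@mul_trunc n) // mulrC. Qed.

Fact fps_mulA : associative fps_mul.
Proof.
move=> s t u; apply/fpsP=> n; rewrite !(@mul_trunc n) //.
transitivity ((trunc n s * (trunc n t * trunc n u))`_n).
  by apply: coefM_eq => // i le_in; rewrite truncE // (mul_trunc _ _ le_in).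
rewrite mulrA.
by apply: coefM_eq => // i le_in; rewrite truncE // (mul_trunc _ _ le_in).
Qed.

Fact fps_mul1 : left_id fps_one fps_mul.
Proof.
move=> s; apply/fpsP=> n /=.
rewrite big_ord_recl /= mul1r subn0 big1 ?addr0 // => i _.
by rewrite mul0r.
Qed.

Fact fps_mulD : left_distributive fps_mul +%R.
Proof.
move=> s t u; apply/fpsP=> n /=; rewrite -big_split /=.
by apply: eq_bigr => i _; rewrite mulrDl.
Qed.

Fact fps_one_neq0 : fps_one != 0.
Proof. by apply/eqP => /fpsP/(_ 0) /=; apply/eqP/oner_neq0. Qed.

HB.instance Definition _ := GRing.Zmodule_isComNzRing.Build (fps R)
  fps_mulA fps_mulC fps_mul1 fps_mulD fps_one_neq0.

Lemma coefs1 n : coefs (1 : fps R) n = (n == 0)%:R. Proof. by []. Qed.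
Lemma coefsM s t n :
  coefs (s * t) n = \sum_(i < n.+1) coefs s i * coefs t (n - i).
Proof. by []. Qed.

End Ring.

Section UnitRing.
Variable R : comUnitRingType.
Implicit Types s t : fps R.

Definition fps_unit : {pred fps R} := fun s => coefs s 0 \is a GRing.unit.

(* The first n+1 coefficients of s^-1, by solving s * s^-1 = 1 recursively.  *)
Fixpoint fps_inv_seq s n : seq R :=
  if n isn't m.+1 then [:: (coefs s 0)^-1] else
  let v := fps_inv_seq s m in
  rcons v (- (coefs s 0)^-1 * \sum_(i < n) coefs s (n - i) * v`_i).

Definition fps_inv s : fps R :=
  if s \in fps_unit then Fps (fun n => (fps_inv_seq s n)`_n) else s.

Let size_inv_seq s n : size (fps_inv_seq s n) = n.+1.
Proof. by elim: n => //= n IHn; rewrite size_rcons IHn. Qed.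

Let nth_inv_seq s n i :
  (i <= n)%N -> (fps_inv_seq s n)`_i = (fps_inv_seq s i)`_i.
Proof.
elim: n => [|n IHn]; first by case: i.
rewrite leq_eqVlt => /predU1P[-> // | lt_in].
by rewrite /= nth_rcons size_inv_seq lt_in IHn.
Qed.

Fact fps_mulVr : {in fps_unit, left_inverse 1 fps_inv *%R}.
Proof.
move=> s Us; apply/fpsP=> n; rewrite coefsM coefs1 /fps_inv Us /=.
case: n => [|n]; first by rewrite big_ord1 mulVr.
rewrite big_ord_recr /= subnn nth_rcons size_inv_seq ltnn eqxx.
rewrite mulrAC mulNr mulVr // mulN1r.
apply/eqP; rewrite subr_eq0; apply/eqP; apply: eq_bigr => i _.
by rewrite mulrC (@nth_inv_seq _ n) // -ltnS.
Qed.

Fact fps_unitP s t : t * s = 1 -> s \in fps_unit.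
Proof.
move/fpsP/(_ 0); rewrite coefsM coefs1 big_ord1 /= => st1.
by apply/unitrPr; exists (coefs t 0); rewrite mulrC.
Qed.

Fact fps_inv_out : {in [predC fps_unit], fps_inv =1 id}.
Proof. by move=> s /negPf Us; rewrite /fps_inv Us. Qed.

HB.instance Definition _ := GRing.ComNzRing_hasMulInverse.Build (fps R)
  fps_mulVr fps_unitP fps_inv_out.

Lemma fps_unitE s : (s \is a GRing.unit) = (coefs s 0 \is a GRing.unit).
Proof. by []. Qed.

End UnitRing.

Definition qpoch_part (j N : nat) : {poly int} :=
  \prod_(1 <= k < N.+1) (1 - 'X^(j * k)).

(* f_j = (q^j; q^j)_oo, for j > 0: the factors with k > n do not contribute to
   the coefficient of q^n, so that f_ j is the q-adic limit of the partial
   products; see [coefs_f].                                                  *)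
Definition f_ (j : nat) : fps int := Fps (fun n => (qpoch_part j n)`_n).

Lemma coefs_f (j n N : nat) : (0 < j)%N -> (n <= N)%N ->
  coefs (f_ j) n = (qpoch_part j N)`_n.
Proof.
move=> j_gt0; elim: N => [|N IHN]; first by case: n.
rewrite leq_eqVlt => /predU1P[-> // | lt_nN]; rewrite IHN //.
rewrite [in RHS]/qpoch_part big_nat_recr //= -/(qpoch_part j N).
rewrite mulrBr mulr1 coefB coefMXn ifT ?subr0 //.
by rewrite (leq_trans lt_nN) // leq_pmull.
Qed.

Lemma f_unit (j : nat) : f_ j \is a GRing.unit.
Proof. by rewrite fps_unitE /= /qpoch_part big_geq // coef1. Qed.

(* a_{1^{t_1} ... m^{t_m}}(n), with [t] the sequence t_1, ..., t_m; [t`_i] is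
   t_{i+1}, and [^] is the power with an integer exponent.                   *)
Definition eta_quotient (t : seq int) : fps int :=
  \prod_(i < size t) f_ i.+1 ^ t`_i.

Definition a_ (t : seq int) (n : nat) : int := coefs (eta_quotient t) n.

Definition S6 : seq (int * int * int * int) :=
  [:: (1, 0, -1, -3); (1, 1, -1, -3); (1, 2, -1, -3); (1, 3, -1, -3);
      (1, 4, -1, -4);
      (2, 0, 0, -2); (2, 1, 0, -2); (2, 2, 0, -2); (2, 3, 0, -3);
      (2, 4, 0, -3);
      (1, 1, 0, -3); (1, 2, 0, -3); (1, 3, 0, -3); (1, 4, 0, -3)].

(* Main.v *)
Require Import Defs.
From HB Require Import structures.
From mathcomp Require Import all_boot all_order all_algebra.
From mathcomp Require Import ring zify.

(* Write P(r, m) = (q^r; q^m)_oo and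
   Theta(x, y) = sum_n q^(x T(n) + y T(-n)), T(n) = n (n + 1) / 2.  The three
   families of S6 are handled alike: by the Jacobi triple product,
     f_1^2 = f_2 Theta'(1,1),  f_1 f_4 = f_2 Theta'(1,3),
     f_1 f_6^2 = f_2 f_3 Theta'(1,5)
   with Theta' the alternating version of Theta, and separating even and odd n
   in the series gives Theta'(1, 2z+1) = rho A - q rho B, where rho substitutes
   -q^2 for q and A, B are again theta products.  As f_2, f_4, f_6 are values
   of rho, the eta quotient has the form rho (V A) - q rho (V B), and the sign
   pattern says that V A and V B have positive coefficients.  This follows by
   writing them as a product of series with nonnegative coefficients
   (theta series, inverses of P(r, m), products of factors 1 + q^k), one of
   them with positive coefficients below some q^r, and one being 1 / P(r, m). *)

Set Implicit Arguments.
Unset Strict Implicit.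
Unset Printing Implicit Defensive.

Import Order.TTheory GRing.Theory Num.Theory.
Local Open Scope ring_scope.

Notation series := (fps int).
Implicit Types (s t u v : series) (b : bool).

(** * Power series modulo q^N *)

Definition q : series := Fps (fun n => (n == 1)%:R).

Lemma coefs_qM s n : coefs (q * s) n = if n is m.+1 then coefs s m else 0.
Proof.
rewrite coefsM; case: n => [|n]; first by rewrite big_ord1 /= mul0r.
rewrite 2!big_ord_recl /= mul0r mul1r add0r subn1 /= big1 ?addr0 // => i _.
by rewrite mul0r.
Qed.

Lemma coefs_qXM k s n :
  coefs (q ^+ k * s) n = if (n < k)%N then 0 else coefs s (n - k).
Proof.
elim: k n => [|k IHk] n; first by rewrite mul1r subn0.
by rewrite exprS -mulrA coefs_qM; case: n => // n; rewrite IHk.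
Qed.

Lemma coefs_qX k n : coefs (q ^+ k) n = (n == k)%:R.
Proof.
rewrite -[q ^+ k]mulr1 coefs_qXM coefs1 subn_eq0.
by case: (ltngtP n k) => //.
Qed.

Lemma coefs_sum (I : Type) (r : seq I) (p : pred I) (F : I -> series) n :
  coefs (\sum_(i <- r | p i) F i) n = \sum_(i <- r | p i) coefs (F i) n.
Proof. by elim/big_rec2: _ => // i x y _ <-. Qed.

(** Congruence modulo q^N, the means of passing from finite products and sums to their limits. Being
    an equality of lists, it is an equivalence by construction. *)
Definition qcong N s t := mkseq (coefs s) N = mkseq (coefs t) N.

Lemma qcongP N s t :
  qcong N s t <-> forall i, (i < N)%N -> coefs s i = coefs t i.
Proof.
split=> [st i iN | st]; last first.
  by apply/eq_in_map => i; rewrite mem_iota add0n => /st.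
by have := congr1 (nth 0 ^~ i) st; rewrite /= !nth_mkseq.
Qed.

Lemma qcong_eq s t : (forall N, qcong N s t) -> s = t.
Proof.
by move=> st; apply/fpsP => n; have /qcongP := st n.+1; apply.
Qed.

Lemma qcongW M N s t : (N <= M)%N -> qcong M s t -> qcong N s t.
Proof.
by move=> NM /qcongP st; apply/qcongP => i iN; apply/st/(leq_trans iN).
Qed.

Lemma qcong_sym N s t : qcong N s t -> qcong N t s. Proof. exact: esym. Qed.

Lemma qcong_trans N s t u : qcong N s t -> qcong N t u -> qcong N s u.
Proof. exact: etrans. Qed.

Lemma qcongD N s t s' t' :
  qcong N s t -> qcong N s' t' -> qcong N (s + s') (t + t').
Proof.
move=> /qcongP st /qcongP st'; apply/qcongP => i iN.
by rewrite !coefsD st ?st'.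
Qed.

Lemma qcongM N s t s' t' :
  qcong N s t -> qcong N s' t' -> qcong N (s * s') (t * t').
Proof.
move=> /qcongP st /qcongP st'; apply/qcongP => i iN.
rewrite !coefsM; apply: eq_bigr => j _.
by rewrite st ?st' // (leq_ltn_trans _ iN) ?leq_subr // -ltnS.
Qed.

Lemma qcong_sum N (I : Type) (r : seq I) (p : pred I) (F G : I -> series) :
  (forall i, p i -> qcong N (F i) (G i)) ->
  qcong N (\sum_(i <- r | p i) F i) (\sum_(i <- r | p i) G i).
Proof.
move=> FG; elim/big_rec2: _ => [|i s t pi st]; first by [].
by apply: qcongD => //; apply: FG.
Qed.

Lemma qcongV N s t : s \is a GRing.unit -> t \is a GRing.unit ->
  qcong N s t -> qcong N s^-1 t^-1.
Proof.
move=> us ut st.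
have e : qcong N (s^-1 * t^-1 * t) (s^-1 * t^-1 * s).
  by apply: qcongM => //; apply: qcong_sym.
by rewrite mulrVK // mulrAC mulVr // mul1r in e.
Qed.

Lemma qcong_qX0 N k s : (N <= k)%N -> qcong N (q ^+ k * s) 0.
Proof.
by move=> Nk; apply/qcongP => i iN; rewrite coefs_qXM (leq_trans iN Nk) coefs0.
Qed.

(** * Infinite products and their partial products *)

(* [qprod true r m] is (q^r; q^m)_oo and [qprod false r m] is (-q^r; q^m)_oo,
   and [pprod] are their partial products.  [qprod] is locked because otherwise
   unification tries to decide [qprod b r m = qprod b' r' m'] for concrete
   parameters by computing coefficients.                                      *)
Definition pprod b r m N : series :=
  \prod_(k < N) (1 + (-1) ^+ b * q ^+ (r + m * k)).

HB.lock Definition qprod (b : bool) (r m : nat) : series :=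
  Fps (fun n => coefs (pprod b r m n.+1) n).

Lemma coefs_qprod b r m n : coefs (qprod b r m) n = coefs (pprod b r m n.+1) n.
Proof. by rewrite unlock. Qed.

(** The last factor is 1 plus or minus q^(r + m N), and r + m N >= N. *)
Lemma qcong_pprodS b r m N : (0 < m)%N ->
  qcong N (pprod b r m N.+1) (pprod b r m N).
Proof.
move=> m0; rewrite /pprod big_ord_recr /= mulrDr mulr1 -[X in qcong _ _ X]addr0.
apply: qcongD => //; rewrite mulrA mulrC; apply: qcong_qX0.
by rewrite (leq_trans _ (leq_addl _ _)) ?leq_pmull.
Qed.

Lemma qcong_pprod b r m M N : (0 < m)%N -> (N <= M)%N ->
  qcong N (pprod b r m M) (pprod b r m N).
Proof.
move=> m0; elim: M => [|M IHM]; first by rewrite leqn0 => /eqP->.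
rewrite leq_eqVlt => /predU1P[-> // | ]; rewrite ltnS => NM.
exact: qcong_trans (qcongW NM (qcong_pprodS _ _ _ m0)) (IHM NM).
Qed.

Lemma qcong_qprod b r m M N : (0 < m)%N -> (N <= M)%N ->
  qcong N (qprod b r m) (pprod b r m M).
Proof.
move=> m0 NM; apply/qcongP => i iN; rewrite coefs_qprod.
have /qcongP -> // := @qcong_pprod b r m M i.+1 m0 (leq_trans iN NM).
Qed.

Lemma coefs_qXM0 k s : (0 < k)%N -> coefs (q ^+ k * s) 0 = 0.
Proof. by move=> k0; rewrite coefs_qXM k0. Qed.

Lemma coefs_M0 s t : coefs (s * t) 0 = coefs s 0 * coefs t 0.
Proof. by rewrite coefsM big_ord1. Qed.

Lemma pprod0 b r m N : (0 < r)%N -> coefs (pprod b r m N) 0 = 1.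
Proof.
move=> r0; rewrite /pprod; elim/big_rec: _ => // i s _ s0.
by rewrite coefs_M0 s0 mulr1 coefsD mulrC coefs_qXM0 ?addr0 // addn_gt0 r0.
Qed.

Lemma qprod_unit b r m : (0 < r)%N -> qprod b r m \is a GRing.unit.
Proof. by move=> r0; rewrite fps_unitE coefs_qprod pprod0. Qed.

Lemma pprod_unit b r m N : (0 < r)%N -> pprod b r m N \is a GRing.unit.
Proof. by move=> r0; rewrite fps_unitE /= pprod0. Qed.

Lemma qprodS b r m : (0 < m)%N ->
  qprod b r m = (1 + (-1) ^+ b * q ^+ r) * qprod b (r + m) m.
Proof.
move=> m0; apply: qcong_eq => N.
apply: (qcong_trans (@qcong_qprod b r m N.+1 N m0 (leqnSn _))).
rewrite /pprod big_ord_recl muln0 addn0; apply: qcongM => //.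
rewrite (eq_bigr (fun k : 'I_N => 1 + (-1) ^+ b * q ^+ (r + m + m * k))).
  exact/qcong_sym/qcong_qprod.
by move=> i _; rewrite /bump /= mulnDr muln1 addnA.
Qed.

(** The factors are sorted by the residue of their index modulo [d]. *)
Lemma qprod_split d b r m : (0 < d)%N -> (0 < m)%N ->
  qprod b r m = \prod_(i < d) qprod b (r + m * i) (d * m).
Proof.
move=> d0 m0; apply: qcong_eq => N.
apply: (qcong_trans (@qcong_qprod b r m (N * d)%N N m0 (leq_pmulr _ d0))).
have -> : pprod b r m (N * d) = \prod_(i < d) pprod b (r + m * i) (d * m) N.
  rewrite exchange_big /= /pprod.
  rewrite -(big_mkord xpredT (fun k => 1 + (-1) ^+ b * q ^+ (r + m * k))).
  rewrite big_nat_mul big_mkord; apply: eq_bigr => j _.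
  rewrite -{1}[(j * d)%N]add0n mulSn big_addn addnK big_mkord.
  by apply: eq_bigr => i _; congr (1 + _ * q ^+ _); lia.
elim/big_rec2: _ => // i s t _ st; apply: qcongM => //.
by apply/qcong_sym/qcong_qprod; rewrite // muln_gt0 d0.
Qed.

Lemma qprod_sqr r m : (0 < m)%N ->
  qprod false r m * qprod true r m = qprod true (2 * r) (2 * m).
Proof.
move=> m0; apply: qcong_eq => N.
apply: (@qcong_trans N _ (pprod false r m N * pprod true r m N)).
  by apply: qcongM; apply: qcong_qprod.
have -> : pprod false r m N * pprod true r m N = pprod true (2 * r) (2 * m) N.
  rewrite /pprod -big_split; apply: eq_bigr => i _ /=.
  have -> : (2 * r + 2 * m * i = (r + m * i) * 2)%N by lia.
  by rewrite exprM expr0 expr1; ring.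
by apply/qcong_sym/qcong_qprod; rewrite // muln_gt0.
Qed.

Lemma f_qprod j : (0 < j)%N -> f_ j = qprod true j j.
Proof.
move=> j0; apply/fpsP => n; rewrite (coefs_f j0 (leqnSn n)) coefs_qprod.
suff -> : pprod true j j n.+1 = Fps (fun i => (qpoch_part j n.+1)`_i) by [].
elim: {n}n.+1 => [|N IHN].
  by apply/fpsP => n; rewrite /pprod /qpoch_part big_ord0 big_geq //= coef1.
rewrite /pprod big_ord_recr -/(pprod _ _ _ _) IHN /qpoch_part.
rewrite [in RHS]big_nat_recr //= -/(qpoch_part j N).
have -> : (j + j * N = j * N.+1)%N by rewrite mulnS.
rewrite expr1 mulrDr mulr1 mulN1r mulrN; apply/fpsP => n.
rewrite coefsD coefsN [_ * q ^+ _]mulrC coefs_qXM /=.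
by rewrite mulrBr mulr1 coefB coefMXn.
Qed.

(** * Triangular exponents and the Jacobi triple product *)

(** T(n) as a natural number. [Negz k] is -(k + 1) and T(-(k + 1)) = T(k), hence the same binomial
    in both branches. *)
Definition tri (n : int) : nat :=
  match n with Posz k => 'C(k.+1, 2) | Negz k => 'C(k.+1, 2) end.

Lemma triE (n : int) : (tri n)%:Z * 2 = n * (n + 1).
Proof.
have e k : ('C(k.+1, 2))%:Z * 2 = k%:Z * (k%:Z + 1).
  have := mul_bin_diag k.+1 1; rewrite bin1 /=; nia.
by case: n => k; rewrite /tri e ?NegzE; lia.
Qed.

Lemma triS (n : int) : (tri (n + 1))%:Z = (tri n)%:Z + n + 1.
Proof. by have := triE n; have := triE (n + 1); lia. Qed.

Lemma triNS (n : int) : (tri (- n))%:Z = (tri (- (n + 1)))%:Z - n.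
Proof. by have := triE (- n); have := triE (- (n + 1)); lia. Qed.

Lemma tri_ge (n : int) : `|n| - 1 <= (tri n)%:Z.
Proof.
by have := triE n; case: n => -[|k]; rewrite ?NegzE /=; nia.
Qed.

Definition jw (R : comNzRingType) (x y : R) (n : int) :=
  x ^+ tri n * y ^+ tri (- n).

(** Consecutive terms have ratio x (x y)^n; writing n = M - k avoids a negative power. *)
Lemma jwS_l (R : comNzRingType) (x y : R) (n : int) (M k : nat) :
    n + k%:Z = M%:Z :> int ->
  (x * y) ^+ k * jw x y (n + 1) = x * (x * y) ^+ M * jw x y n.
Proof.
move=> nk; rewrite /jw.
have e1 : (k + tri (n + 1) = 1 + M + tri n)%N by have := triS n; lia.
have e2 : (k + tri (- (n + 1)) = M + tri (- n))%N.
  by have := triNS n; lia.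
rewrite !exprMn.
transitivity (x ^+ (k + tri (n + 1)) * y ^+ (k + tri (- (n + 1)))).
  by rewrite !exprD; ring.
by rewrite e1 e2 !exprD expr1; ring.
Qed.

Lemma jwC (R : comNzRingType) (x y : R) (n : int) : jw x y n = jw y x (- n).
Proof. by rewrite /jw opprK mulrC. Qed.

(* The finite form of the triple product,
     prod_(k < M) (1 + x c^k) prod_(k < N) (1 + y c^k)
       = sum_(-N <= n <= M) [M+N; N+n]_c x^T(n) y^T(-n)   with c = x y,
   is proved by induction; [qbinom i j] is the Gaussian binomial [i+j; i]_c.  *)
Section JacobiTripleProduct.
Variable m : nat.
Hypothesis m_gt0 : (0 < m)%N.
Implicit Types i j k : nat.

Local Notation c := (q ^+ m).
Local Notation poch := (pprod true m m).

Definition qbinom i j := poch (i + j) / (poch i * poch j).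

Lemma pochS k : poch k.+1 = poch k * (1 - c ^+ k.+1).
Proof. by rewrite /pprod big_ord_recr /= expr1 mulN1r -mulnS exprM. Qed.

Lemma poch_unit k : poch k \is a GRing.unit.
Proof. exact: pprod_unit. Qed.

Lemma qbinomE i j : qbinom i j * (poch i * poch j) = poch (i + j).
Proof. by rewrite /qbinom mulrVK // unitrM !poch_unit. Qed.

Lemma qbinom0n j : qbinom 0 j = 1.
Proof.
by rewrite /qbinom {2}/pprod big_ord0 mul1r add0n divrr ?poch_unit.
Qed.

Lemma qbinomn0 i : qbinom i 0 = 1.
Proof.
by rewrite /qbinom {3}/pprod big_ord0 mulr1 addn0 divrr ?poch_unit.
Qed.

(** The q-Pascal rule. Cleared of denominators it comes down to 1 - c^(i+j+2) = (1 - c^(j+1)) +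
    c^(j+1) (1 - c^(i+1)). *)
Lemma qbinomS_l i j :
  qbinom i.+1 j.+1 = qbinom i.+1 j + c ^+ j.+1 * qbinom i j.+1.
Proof.
apply: (@mulIr _ (poch i.+1 * poch j.+1)); first by rewrite unitrM !poch_unit.
rewrite qbinomE mulrDl.
have -> : qbinom i.+1 j * (poch i.+1 * poch j.+1) =
    poch (i + j).+1 * (1 - c ^+ j.+1).
  by rewrite (pochS j) !mulrA -[_ * _ * poch j]mulrA qbinomE addSn.
have -> : c ^+ j.+1 * qbinom i j.+1 * (poch i.+1 * poch j.+1) =
    c ^+ j.+1 * (poch (i + j).+1 * (1 - c ^+ i.+1)).
  by rewrite (pochS i) -[(i + j).+1]addnS -qbinomE; ring.
have e : c ^+ (i + j).+2 = c ^+ i.+1 * c ^+ j.+1.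
  by rewrite -exprD addSn addnS.
by rewrite addSn addnS pochS e; ring.
Qed.

Lemma qbinomC i j : qbinom i j = qbinom j i.
Proof. by rewrite /qbinom addnC [poch j * _]mulrC. Qed.

Implicit Types M N : nat.

Definition jsum x y M N : series :=
  \sum_(i < (M + N).+1) qbinom i (M + N - i) * jw x y (i%:Z - N%:Z).

(** The q-Pascal rule splits each inner coefficient in two: one part restores [jsum x y M N], the
    other, by the ratio of consecutive terms, its multiple by [x * c ^+ M]. The two extreme
    coefficients are 1. *)
Lemma jsumS_l x y M N : x * y = c ->
  jsum x y M.+1 N = (1 + x * c ^+ M) * jsum x y M N.
Proof.
move=> xy.
rewrite /jsum mulrDl mul1r addSn big_ord_recr big_ord_recl /=.
rewrite [X in _ = X + _]big_ord_recl [X in _ = _ + _ * X]big_ord_recr /=.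
rewrite mulrDr mulr_sumr !subnn !subn0 !qbinom0n !qbinomn0 !mul1r -!addrA.
congr (_ + _); rewrite addrA -big_split /=; congr (_ + _).
  apply: eq_bigr => i _; have iM := ltn_ord i.
  rewrite /bump /= add1n.
  have e : (M + N - i = (M + N - i.+1).+1)%N by lia.
  rewrite subSS e qbinomS_l mulrDl; congr (_ + _).
  rewrite (_ : i.+1%:Z - N%:Z = i%:Z - N%:Z + 1); last by lia.
  rewrite -xy mulrAC (@jwS_l _ _ _ _ M) ?[_ * qbinom _ _]mulrC; last by lia.
  by rewrite mulrCA.
rewrite (_ : (M + N).+1%:Z - N%:Z = (M + N)%:Z - N%:Z + 1); last by lia.
by have := @jwS_l _ x y ((M + N)%:Z - N%:Z) M 0; rewrite mul1r xy; apply; lia.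
Qed.

(** Reversing the summation replaces n by -n, which exchanges x and y. *)
Lemma jsumC x y M N : jsum x y M N = jsum y x N M.
Proof.
rewrite /jsum addnC (reindex_inj rev_ord_inj); apply: eq_bigr => i _ /=.
have iM := ltn_ord i; rewrite subSS qbinomC jwC; congr (qbinom _ _ * jw _ _ _).
all: lia.
Qed.

Lemma jsumS_r x y M N : x * y = c ->
  jsum x y M N.+1 = (1 + y * c ^+ N) * jsum x y M N.
Proof.
by move=> xy; rewrite jsumC jsumS_l ?[jsum y _ _ _]jsumC // mulrC.
Qed.

Lemma jsumE x y M N : x * y = c ->
  jsum x y M N =
    \prod_(k < M) (1 + x * c ^+ k) * \prod_(k < N) (1 + y * c ^+ k).
Proof.
move=> xy; elim: M => [|M IHM].
  elim: N => [|N IHN].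
    by rewrite /jsum !big_ord0 big_ord1 qbinom0n /jw !mul1r.
  by rewrite jsumS_r // IHN !big_ord0 !mul1r big_ord_recr mulrC.
by rewrite jsumS_l // IHM big_ord_recr /= mulrA [_ * (1 + _)]mulrC.
Qed.

(** Modulo q^K all three partial products in [qbinom i j] agree with [qprod true m m]. *)
Lemma qbinom_lim K i j : (K <= i)%N -> (K <= j)%N ->
  qcong K (qprod true m m * qbinom i j) 1.
Proof.
move=> Ki Kj; have u := qprod_unit true m m_gt0.
have P k : (K <= k)%N -> qcong K (poch k) (qprod true m m).
  by move=> Kk; apply/qcong_sym/qcong_qprod.
rewrite -[1](divrr (_ : qprod true m m * qprod true m m \is a GRing.unit)).
  rewrite -mulrA; apply: qcongM => //; apply: qcongM.
    by apply: P; rewrite (leq_trans Ki) ?leq_addr.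
  apply: qcongV; rewrite ?unitrM ?poch_unit ?u //.
  by apply: qcongM; apply: P.
by rewrite unitrM u.
Qed.

End JacobiTripleProduct.

(** * Theta products and their series *)

(** The product side of the triple product; [qcong_theta] gives the series side. The value [y = 0]
    does occur, in [theta false 4 0]. *)
Definition theta b x y := qprod b x (x + y) * qprod b y (x + y) *
  qprod true (x + y) (x + y).

(** Since T(n) + T(-n) = n^2, the sign for [b = true] is (-1)^n. *)
Definition theta_term b x y (n : int) : series :=
  jw ((-1) ^+ b * q ^+ x) ((-1) ^+ b * q ^+ y) n.

Lemma theta_termE b x y (n : int) : theta_term b x y n =
  (-1) ^+ (b * (tri n + tri (- n))) * q ^+ (x * tri n + y * tri (- n)).
Proof.
by rewrite /theta_term /jw !exprMn -!exprM exprD mulnDr exprD; ring.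
Qed.

Lemma qcong_theta_term0 K b x y (n : int) : (0 < x + y)%N -> (K < `|n|)%N ->
  qcong K (theta_term b x y n) 0.
Proof.
move=> xy Kn; rewrite theta_termE mulrC; apply: qcong_qX0.
(* One of x, y is positive, and T(n), T(-n) are both at least |n| - 1 >= K. *)
by have := tri_ge n; have := tri_ge (- n); nia.
Qed.

Lemma qcong_theta b x y K M N : (0 < x + y)%N ->
    (2 * K <= M)%N -> (2 * K <= N)%N ->
  qcong K (theta b x y)
    (\sum_(i < (M + N).+1) theta_term b x y (i%:Z - N%:Z)).
Proof.
move=> xy_gt0 KM KN.
have xy : (-1) ^+ b * q ^+ x * ((-1) ^+ b * q ^+ y) = q ^+ (x + y).
  by rewrite mulrACA -expr2 sqrr_sign mul1r exprD.
have pE z L : pprod b z (x + y) L =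
    \prod_(k < L) (1 + (-1) ^+ b * q ^+ z * (q ^+ (x + y)) ^+ k).
  by apply: eq_bigr => k _; rewrite -mulrA -exprM -exprD.
apply: (@qcong_trans _ _ (jsum (x + y) ((-1) ^+ b * q ^+ x)
    ((-1) ^+ b * q ^+ y) M N * qprod true (x + y) (x + y))).
  rewrite jsumE // -!pE; apply: qcongM => //.
  by apply: qcongM; apply: qcong_qprod => //; lia.
rewrite mulr_suml; apply: qcong_sum => i _; rewrite mulrAC mulrC.
(* With n = i - N, terms with |n| > K vanish modulo q^K. If |n| <= K, the bounds 2 K <= M, N make
   both entries of the q-binomial at least K. *)
have [Ki | Ki] := leqP `|i%:Z - N%:Z| K; last first.
  have e := qcong_theta_term0 b xy_gt0 Ki.
  apply: (qcong_trans (t := 0)); last exact: qcong_sym.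
  move: (qbinom _ _ _ * _) => u.
  by rewrite -[X in qcong _ _ X](mul0r u); apply: qcongM.
rewrite -[X in qcong _ _ X]mulr1; apply: qcongM => //.
by rewrite mulrC; apply: qbinom_lim; lia.
Qed.

(** * The substitution of -q^2 for q and the splitting of theta series *)

Definition rho s : series :=
  Fps (fun n => if odd n then 0 else (-1) ^+ n./2 * coefs s n./2).

Fact rho_zmod : zmod_morphism rho.
Proof.
move=> s t; apply/fpsP => n; rewrite coefsD coefsN /=.
by case: ifP => _; rewrite ?subr0 // -mulrBr.
Qed.

Lemma sum_ord_double (V : nmodType) (F : nat -> V) m :
  \sum_(i < 2 * m) F i = \sum_(i < m) (F (2 * i)%N + F (2 * i + 1)%N).
Proof.
elim: m => [|m IHm]; first by rewrite !big_ord0.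
rewrite [RHS]big_ord_recr /= -IHm.
have -> : (2 * m.+1 = (2 * m).+2)%N by lia.
by rewrite 2!big_ord_recr /= addn1 addrA.
Qed.

Fact rho_monoid : monoid_morphism rho.
Proof.
split=> [|s t]; first by apply/fpsP => -[|[|n]] //=; case: ifP; rewrite ?mulr0.
apply/fpsP => n; rewrite coefsM /=.
have [on | en] := boolP (odd n).
  (* For odd n, one of i and n - i is odd, so one factor is 0. *)
  rewrite big1 // => i _; have in_ := ltn_ord i; rewrite ltnS in in_.
  have := oddB in_; rewrite on; case: (odd i) => /=; first by rewrite mul0r.
  by move=> ->; rewrite mulr0.
have -> : n = (2 * n./2)%N by rewrite mul2n even_halfK.
move: n./2 => m {n en}.
set F := fun i : nat => (if odd i then 0 else (-1) ^+ i./2 * coefs s i./2) *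
  (if odd (2 * m - i) then 0
   else (-1) ^+ (2 * m - i)./2 * coefs t (2 * m - i)./2).
rewrite [RHS](_ : _ = \sum_(i < (2 * m).+1) F i) // [RHS]big_ord_recr /=.
(* Odd indices contribute 0; the last index 2 m, set apart before pairing, then rejoins the even
   ones. *)
rewrite (sum_ord_double F) big_split /= [X in _ + X + _]big1 ?addr0; last first.
  by move=> i _; rewrite /F addn1 /= mul2n odd_double mul0r.
rewrite -(big_ord_recr m (fun i : 'I_m.+1 => F (2 * i)%N)) /=.
rewrite mul2n doubleK mulr_sumr; apply: eq_bigr => i _; rewrite /F.
have im := ltn_ord i; rewrite ltnS in im.
rewrite !mul2n -doubleB !odd_double !doubleK mulrACA -exprD.
by rewrite subnKC.
Qed.

HB.instance Definition _ :=
  GRing.isZmodMorphism.Build series series rho rho_zmod.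
HB.instance Definition _ :=
  GRing.isMonoidMorphism.Build series series rho rho_monoid.

Lemma rho_q : rho q = - q ^+ 2.
Proof.
apply/fpsP => n; rewrite coefsN coefs_qX.
by case: n => [|[|[|[|n]]]] //=; case: ifP; rewrite ?mulr0.
Qed.

Lemma qcong_rho N s t : qcong N s t -> qcong N (rho s) (rho t).
Proof.
move=> /qcongP st; apply/qcongP => i iN /=; case: ifP => // _.
by rewrite st //; lia.
Qed.

Lemma rho_qX k : rho (q ^+ k) = (-1) ^+ k * q ^+ (2 * k).
Proof. by rewrite rmorphXn /= rho_q [LHS]exprNn exprM. Qed.

(** As m is even, all exponents r + m k have the parity of r, so every factor gets the same sign
    change. *)
Lemma rho_qprod b r m : (0 < m)%N -> ~~ odd m ->
  rho (qprod b r m) = qprod (b (+) odd r) (2 * r) (2 * m).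
Proof.
move=> m0 em; apply: qcong_eq => N.
apply: (@qcong_trans N _ (rho (pprod b r m N))).
  by apply: qcong_rho; apply: qcong_qprod.
have -> : rho (pprod b r m N) = pprod (b (+) odd r) (2 * r) (2 * m) N.
  rewrite /pprod rmorph_prod; apply: eq_bigr => k _ /=.
  rewrite rmorphD rmorph1 rmorphM /= rmorph_sign rho_qX mulrA.
  rewrite -[(-1) ^+ (r + m * k)]signr_odd oddD oddM (negPf em) addbF.
  by rewrite -signr_addb mulnDr mulnA.
by apply/qcong_sym/qcong_qprod; rewrite // muln_gt0.
Qed.

(** Here and in [tri_doubleS] the exponents at 2 n and 2 n + 1 become combinations of T(n) and
    T(-n), so that each half of a theta series is again one. *)
Lemma tri_double (n : int) :
  tri (2 * n) = (3 * tri n + tri (- n))%N /\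
  tri (- (2 * n)) = (tri n + 3 * tri (- n))%N.
Proof.
have := triE n; have := triE (- n); have := triE (2 * n).
by have := triE (- (2 * n)); split; nia.
Qed.

Lemma tri_doubleS (n : int) :
  (tri (2 * n + 1) + tri (- n) = 5 * tri n + 1)%N /\
  tri (- (2 * n + 1)) = (3 * tri n + tri (- n))%N.
Proof.
have := triE n; have := triE (- n); have := triE (2 * n + 1).
by have := triE (- (2 * n + 1)); split; nia.
Qed.

Lemma rho_theta_term b x y (n : int) : rho (theta_term b x y n) =
  (-1) ^+ (b * (tri n + tri (- n)) + (x * tri n + y * tri (- n))) *
  q ^+ (2 * (x * tri n + y * tri (- n))).
Proof.
by rewrite theta_termE rmorphM /= rmorphXn rmorphN rmorph1 rho_qX mulrA -exprD.
Qed.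

(** The sign at index 2 n is +1. On the right, [rho] produces (-1)^(z (T(n) + T(-n))), which the
    sign flag [odd z] cancels. *)
Lemma theta_term_double z (n : int) :
  theta_term true 1 (2 * z + 1) (2 * n) =
  rho (theta_term (odd z) (z + 2) (3 * z + 2) n).
Proof.
rewrite theta_termE rho_theta_term; case: (tri_double n) => -> ->.
congr (_ * q ^+ _); last by lia.
rewrite -[LHS]signr_odd -[RHS]signr_odd; congr (_ ^+ _).
rewrite !(oddD, oddM) /= !oddb.
by case: (odd z) (odd (tri n)) (odd (tri (- n))) => [] [] [].
Qed.

Lemma theta_term_doubleS z (n : int) :
  theta_term true 1 (2 * z + 1) (2 * n + 1) =
  - (q * rho (theta_term (odd z) (3 * z + 4) z n)).
Proof.
rewrite theta_termE rho_theta_term; case: (tri_doubleS n) => e ->.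
rewrite mulrCA -exprS -[RHS]mulN1r mulrA -exprS.
congr (_ * q ^+ _); last by lia.
rewrite -[LHS]signr_odd -[RHS]signr_odd; congr (_ ^+ _).
have := congr1 odd e.
rewrite /= !(oddD, oddM) /= !oddb; case: (odd (tri (2 * n + 1)));
  by case: (odd z) (odd (tri n)) (odd (tri (- n))) => [] [] [].
Qed.

Lemma theta_split z : theta true 1 (2 * z + 1) =
  rho (theta (odd z) (z + 2) (3 * z + 2)) -
  q * rho (theta (odd z) (3 * z + 4) z).
Proof.
apply: qcong_eq => K; set N := (2 * K)%N.
(* The indices from -2 N to 2 N + 1 pair off as 2 n, 2 n + 1 for -N <= n <= N. *)
have e0 := @qcong_theta true 1 (2 * z + 1) K (2 * N).+1 (2 * N).
have e1 := @qcong_theta (odd z) (z + 2) (3 * z + 2) K N N.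
have e2 := @qcong_theta (odd z) (3 * z + 4) z K N N.
apply: qcong_trans (e0 _ _ _) _; [lia..|]; apply: qcong_sym.
rewrite -mulrN -raddfN /=.
apply: (@qcong_trans _ _ (rho (\sum_(i < (N + N).+1)
     theta_term (odd z) (z + 2) (3 * z + 2) (i%:Z - N%:Z)) -
   q * rho (\sum_(i < (N + N).+1)
     theta_term (odd z) (3 * z + 4) z (i%:Z - N%:Z)))).
  apply: qcongD; first by apply/qcong_rho/e1; lia.
  rewrite raddfN mulrN -!mulNr; apply: qcongM => //.
  by apply/qcong_rho/e2; lia.
rewrite !rmorph_sum mulr_sumr -sumrN -big_split /=.
have -> : ((2 * N).+1 + 2 * N = (2 * (N + N)).+1)%N by lia.
have -> : ((2 * (N + N)).+2 = 2 * (N + N).+1)%N by lia.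
rewrite (sum_ord_double
  (fun i => theta_term true 1 (2 * z + 1) (i%:Z - (2 * N)%N%:Z))).
apply: qcong_sum => i _; rewrite -theta_term_double -theta_term_doubleS.
rewrite (_ : (2 * i)%N%:Z - (2 * N)%N%:Z = 2 * (i%:Z - N%:Z)); last by lia.
rewrite (_ : (2 * i + 1)%N%:Z - (2 * N)%N%:Z = 2 * (i%:Z - N%:Z) + 1) //.
by lia.
Qed.

(** The coefficient of q^(2k) in s is (-1)^k t_k, that of q^(2k+1) is -(-1)^k u_k: the signs are +,
    -, -, + modulo 4. *)
Lemma sign_pattern s t u : s = rho t - q * rho u ->
    (forall n, 0 < coefs t n) -> (forall n, 0 < coefs u n) ->
  forall n : nat, [/\ 0 < coefs s (4 * n)%N, coefs s (4 * n + 1)%N < 0,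
    coefs s (4 * n + 2)%N < 0 & 0 < coefs s (4 * n + 3)%N].
Proof.
move=> -> t0 u0 n.
have rE v k : coefs (rho v) (2 * k)%N = (-1) ^+ k * coefs v k.
  by rewrite /= mul2n odd_double doubleK.
have rO v k : coefs (rho v) (2 * k).+1 = 0.
  by rewrite /= mul2n odd_double.
have sE k : coefs (rho t - q * rho u) (2 * k)%N = (-1) ^+ k * coefs t k.
  rewrite coefsD coefsN coefs_qM rE; case: k => [|k]; first by rewrite subr0.
  by rewrite (_ : 2 * k.+1 = (2 * k).+2)%N ?rO ?subr0 //; lia.
have sO k : coefs (rho t - q * rho u) (2 * k).+1 = - ((-1) ^+ k * coefs u k).
  by rewrite coefsD coefsN coefs_qM rO rE add0r.
have -> : (4 * n = 2 * (2 * n))%N by lia.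
have -> : (2 * (2 * n) + 1 = (2 * (2 * n)).+1)%N by lia.
have -> : (2 * (2 * n) + 2 = 2 * (2 * n).+1)%N by lia.
have -> : (2 * (2 * n) + 3 = (2 * (2 * n).+1).+1)%N by lia.
by rewrite !sE !sO !exprS exprM sqrrN !expr1n !mul1r !mulN1r opprK !oppr_lt0.
Qed.

(** * Nonnegative series and positive coefficients *)

(** The list [l] records exponents known to have positive coefficients; under products these lists
    add up elementwise. *)
Definition ppos (l : seq nat) s :=
  (forall n, 0 <= coefs s n) /\ (forall i, i \in l -> 0 < coefs s i).

Lemma ppos_sub (l l' : seq nat) s : all (mem l) l' -> ppos l s -> ppos l' s.
Proof. by move=> /allP l'l [s0 sl]; split=> // i /l'l; apply: sl. Qed.

Lemma coefsM_gt0 s t i j :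
    (forall n, 0 <= coefs s n) -> (forall n, 0 <= coefs t n) ->
  0 < coefs s i -> 0 < coefs t j -> 0 < coefs (s * t) (i + j).
Proof.
move=> s0 t0 si tj; have ij : (i < (i + j).+1)%N by rewrite ltnS leq_addr.
rewrite coefsM (bigD1 (Ordinal ij)) //= addKn ltr_wpDr ?mulr_gt0 //.
by apply: sumr_ge0 => k _; apply: mulr_ge0.
Qed.

Lemma pposM (l l' : seq nat) s t : ppos l s -> ppos l' t ->
  ppos [seq (i + j)%N | i <- l, j <- l'] (s * t).
Proof.
move=> [s0 sl] [t0 tl]; split=> [n | k /allpairsP[[i j] /= [il jl ->]]].
  by rewrite coefsM; apply: sumr_ge0 => k _; apply: mulr_ge0.
by apply: coefsM_gt0 => //; [apply: sl | apply: tl].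
Qed.

Lemma ppos_lim (l : seq nat) s :
    (forall N, exists2 t, qcong N s t & ppos l t) -> ppos l s.
Proof.
move=> st; split=> [n | n nl].
  by have [t /qcongP -> // []] := st n.+1.
by have [t /qcongP -> // [_ ->]] := st n.+1.
Qed.

Lemma ppos1 : ppos [:: 0] 1.
Proof.
split=> [n | i]; first by rewrite coefs1 ler0n.
by rewrite inE => /eqP->; rewrite coefs1.
Qed.

Lemma ppos_prod (I : Type) (r : seq I) (p : pred I) (F : I -> series) :
  (forall i, p i -> ppos [:: 0] (F i)) ->
  ppos [:: 0] (\prod_(i <- r | p i) F i).
Proof.
move=> F0; elim/big_rec: _ => [|i s pi s0]; first exact: ppos1.
exact: ppos_sub (pposM (F0 i pi) s0).
Qed.

Lemma ppos_1D k : (0 < k)%N -> ppos [:: 0; k] (1 + q ^+ k).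
Proof.
move=> k0; split=> [n | i]; rewrite coefsD coefs1 coefs_qX.
  by rewrite addr_ge0 ?ler0n.
by rewrite !inE => /orP[] /eqP ->; rewrite eqxx; case: eqP.
Qed.

Lemma ppos_qprod r m : (0 < r)%N -> (0 < m)%N ->
  ppos [:: 0; r] (qprod false r m).
Proof.
move=> r0 m0; have p0 k : (0 < k)%N -> ppos [:: 0] (qprod false k m).
  move=> k0; apply: ppos_lim => N; exists (pprod false k m N).
    exact: qcong_qprod.
  apply: ppos_prod => i _; rewrite expr0 mul1r.
  by apply: (ppos_sub _ (ppos_1D _)); rewrite ?addn_gt0 ?k0 //= inE eqxx.
rewrite qprodS // expr0 mul1r.
apply: ppos_sub (pposM (ppos_1D r0) (p0 (r + m)%N _)); last by lia.
by rewrite /= !inE !addn0 !eqxx orbT.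
Qed.

Definition geom r : series := Fps (fun n => (r %| n)%:R).

Lemma geomE r : (0 < r)%N -> (1 - q ^+ r) * geom r = 1.
Proof.
move=> r0; apply/fpsP => n; rewrite mulrBl mul1r coefsD coefsN coefs_qXM coefs1.
rewrite /=; case: ltnP => [nr|rn].
  case: n nr => [|n] nr; first by rewrite dvdn0 subr0.
  by rewrite gtnNdvd // subr0.
by rewrite dvdn_subl // subrr; case: n rn r0 => // /leq_gtF->.
Qed.

Lemma ppos_geom r : ppos [:: 0] (geom r).
Proof.
split=> [n | i]; first by rewrite ler0n.
by rewrite inE => /eqP-> /=; rewrite dvdn0.
Qed.

Lemma one_sub_qX_unit r : (0 < r)%N -> 1 - q ^+ r \is a GRing.unit.
Proof.
by move=> r0; apply/unitrPr; exists (geom r); apply: geomE.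
Qed.

Lemma geom_inv r : (0 < r)%N -> (1 - q ^+ r)^-1 = geom r.
Proof.
move=> r0; apply: (mulrI (one_sub_qX_unit r0)).
by rewrite geomE // divrr // one_sub_qX_unit.
Qed.

Lemma ppos_qprodV r m : (0 < r)%N -> (0 < m)%N ->
  ppos [:: 0] (qprod true r m)^-1.
Proof.
move=> r0 m0; apply: ppos_lim => N; exists (pprod true r m N)^-1.
  by apply: qcongV; rewrite ?qprod_unit ?pprod_unit //; apply: qcong_qprod.
elim: N => [|N IHN]; first by rewrite /pprod big_ord0 invr1; apply: ppos1.
rewrite /pprod big_ord_recr -/(pprod _ _ _ _) /=.
have k0 : (0 < r + m * N)%N by rewrite addn_gt0 r0.
rewrite expr1 mulN1r invrM ?pprod_unit ?one_sub_qX_unit // geom_inv //.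
exact: ppos_sub (pposM (ppos_geom _) IHN).
Qed.

(** The factor 1 / (1 - q^r) has coefficient 1 at all multiples of r, and [s] is positive at n mod
    r; together they reach n. The other factors of 1 / P(r, m) have constant term 1. *)
Lemma positive_div r m s : (0 < r)%N -> (0 < m)%N -> ppos (iota 0 r) s ->
  forall n, 0 < coefs (s / qprod true r m) n.
Proof.
move=> r0 m0 [s0 sr] n.
have u : qprod true (r + m) m \is a GRing.unit.
  by rewrite qprod_unit // addn_gt0 r0.
rewrite qprodS // expr1 mulN1r invrM ?one_sub_qX_unit // geom_inv //.
rewrite mulrCA mulrC -[n]addn0.
have [v0 v1] : ppos [:: 0] (qprod true (r + m) m)^-1.
  by apply: ppos_qprodV => //; rewrite addn_gt0 r0.
have [g0 g1] := ppos_geom r.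
apply: coefsM_gt0 => //; last by apply: v1; rewrite inE.
  by move=> k; rewrite coefsM; apply: sumr_ge0 => i _; apply: mulr_ge0.
rewrite (divn_eq n r) addnC; apply: coefsM_gt0 => //.
  by apply: sr; rewrite mem_iota ltn_mod.
by rewrite /= dvdn_mull.
Qed.

Lemma positive_mul s t : (forall n, 0 < coefs s n) -> ppos [:: 0] t ->
  forall n, 0 < coefs (s * t) n.
Proof.
move=> s0 [t0 t1] n; rewrite -[n]addn0; apply: coefsM_gt0 => //.
  by move=> k; apply: ltW.
by apply: t1; rewrite inE.
Qed.

(** For [b = false] each term of the series is a bare power of q, so nothing cancels; [l] lists
    chosen indices n. *)
Lemma ppos_theta x y (l : seq int) : (0 < x + y)%N ->
  ppos [seq (x * tri n + y * tri (- n))%N | n <- l] (theta false x y).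
Proof.
move=> xy; have T0 (n : int) k : coefs (theta_term false x y n) k =
    (k == x * tri n + y * tri (- n))%N%:R.
  by rewrite theta_termE mul0n mul1r coefs_qX.
split=> [k | _ /mapP[n _ ->]].
  have /qcongP -> // := qcong_theta false xy (leqnn (2 * k.+1)) (leqnn _).
  by rewrite coefs_sum; apply: sumr_ge0 => i _; rewrite T0 ler0n.
(* N must be large enough both for the congruence up to q^k and for the index n to lie in the
   range. *)
set k := (_ + _)%N; pose N := (2 * k.+1 + `|n|)%N.
have kN : (2 * k.+1 <= N)%N by rewrite leq_addr.
have /qcongP -> // := qcong_theta false xy kN kN.
rewrite coefs_sum.
have iN : (`|(n + N%:Z)%R| < (N + N).+1)%N by lia.
rewrite (bigD1 (Ordinal iN)) // ltr_wpDr //.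
  by apply: sumr_ge0 => i _; rewrite T0 ler0n.
rewrite [nat_of_ord _]/= (_ : `|(n + N%:Z)%R|%N%:Z - N%:Z = n); last by lia.
by rewrite T0 eqxx.
Qed.

(** * Theta products and eta quotients *)

Local Notation F j := (qprod true j j).
(** Ramanujan's chi(q). Likewise [theta false 1 1] is phi(q) and [theta false 1 3] is psi(q). *)
Local Notation chi := (qprod false 1 2).

Lemma mul_fV j : (0 < j)%N -> F j * (F j)^-1 = 1.
Proof. by move=> j0; rewrite divrr // qprod_unit. Qed.

(* Lets [ring] prove identities with inverses: s and t are products of trivial
   factors x * x^-1.                                                          *)
Lemma eq_mul1 u v s t : s = 1 -> t = 1 -> u * s = v * t -> u = v.
Proof. by move=> -> ->; rewrite !mulr1. Qed.

Lemma qprod_split2 b r m : (0 < m)%N ->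
  qprod b r m = qprod b r (2 * m) * qprod b (r + m) (2 * m).
Proof.
move=> m0; rewrite (@qprod_split 2) // 2!big_ord_recr big_ord0 /= mul1r.
by rewrite muln0 addn0 muln1.
Qed.

Lemma qprod_split3 b r m : (0 < m)%N ->
  qprod b r m = qprod b r (3 * m) * qprod b (r + m) (3 * m) *
    qprod b (r + 2 * m) (3 * m).
Proof.
move=> m0; rewrite (@qprod_split 3) // 3!big_ord_recr big_ord0 /= mul1r.
by rewrite muln0 addn0 muln1 [(m * 2)%N]mulnC.
Qed.

Lemma rho_f j : (0 < j)%N -> ~~ odd j -> rho (F j) = F (2 * j).
Proof. by move=> j0 ej; rewrite rho_qprod // (negPf ej). Qed.

(** For odd j the argument of [rho] is f_j at -q, so its image is f_j at q^2. *)
Lemma rho_neg_f j : odd j ->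
  rho (qprod false j (2 * j) * F (2 * j)) = F (2 * j).
Proof.
move=> oj; have j0 : (0 < j)%N by case: j oj.
rewrite rmorphM /= !rho_qprod ?muln_gt0 ?mul2n ?odd_double //= oj /=.
by rewrite [RHS]qprod_split2 ?double_gt0 // -!mul2n addnn -mul2n.
Qed.

Lemma theta11 : theta false 1 1 = F 2 * chi ^+ 2.
Proof. by rewrite /theta mulrC expr2. Qed.

Lemma theta13 : theta false 1 3 = chi * F 4.
Proof. by rewrite (qprod_split2 false 1 (m := 2)). Qed.

Lemma f1_split : F 1 = qprod true 1 2 * F 2.
Proof. by rewrite (qprod_split2 true 1 (m := 1)). Qed.

Lemma theta_true11 : F 1 ^+ 2 = F 2 * theta true 1 1.
Proof. by rewrite f1_split /theta; ring. Qed.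

Lemma theta_true13 : F 1 * F 4 = F 2 * theta true 1 3.
Proof. by rewrite f1_split (qprod_split2 true 1 (m := 2)) // /theta; ring. Qed.

Lemma theta_true15 : F 1 * F 6 ^+ 2 = F 2 * F 3 * theta true 1 5.
Proof.
rewrite f1_split (qprod_split3 true 1 (m := 2)) //.
rewrite (qprod_split2 true 3 (m := 3)) //.
by rewrite /theta /=; ring.
Qed.

(* [n1] and [n3] are f_1 and f_3 at -q. *)
Local Notation n1 := (chi * F 2).
Local Notation n3 := (qprod false 3 6 * F 6).

Lemma rho_n1 : rho n1 = F 2.
Proof. exact: (rho_neg_f (j := 1)). Qed.

Lemma rho_n3 : rho n3 = F 6.
Proof. exact: (rho_neg_f (j := 3)). Qed.

Lemma rho_f2 : rho (F 2) = F 4.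
Proof. exact: (rho_f (j := 2)). Qed.

Lemma eta_quotientE (t1 t2 t3 t4 : int) : eta_quotient [:: t1; t2; t3; t4] =
  F 1 ^ t1 * F 2 ^ t2 * F 3 ^ t3 * F 4 ^ t4.
Proof.
rewrite /eta_quotient !big_ord_recl big_ord0 /= !f_qprod //.
by rewrite mulr1 !mulrA.
Qed.

(** The quotient is f_2^(k+1) f_4^(-e) Theta'(1,1), with f_2 and f_4 the images of [n1] and
    [F 2]. *)
Lemma eta_quotient_2_k_0 (k e : nat) : eta_quotient [:: 2; k%:Z; 0; - e%:Z] =
  rho (n1 ^+ k.+1 * (F 2)^-1 ^+ e) * theta true 1 1.
Proof.
rewrite eta_quotientE rmorphM /= !rmorphXn /= rmorphV ?qprod_unit //=.
rewrite rho_n1 rho_f2.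
rewrite expr0z -exprnN -exprVn -!exprnP theta_true11 (exprS _ k); ring.
Qed.

(** The quotient is f_2^(k+1) f_6^(-2) f_4^(-e) Theta'(1,5), with f_6 the image of [n3]. *)
Lemma eta_quotient_1_k_m1 (k e : nat) : eta_quotient [:: 1; k%:Z; -1; - e%:Z] =
  rho (n1 ^+ k.+1 * n3^-1 ^+ 2 * (F 2)^-1 ^+ e) * theta true 1 5.
Proof.
rewrite eta_quotientE !rmorphM /= !rmorphXn /=.
rewrite !rmorphV ?unitrM ?qprod_unit //=.
rewrite rho_n1 rho_n3 rho_f2.
rewrite exprN1 -exprnN -exprVn -!exprnP expr1.
apply: (eq_mul1 (s := (F 6 * (F 6)^-1) ^+ 2) (t := F 3 * (F 3)^-1)).
- by rewrite mul_fV ?expr1n.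
- by rewrite mul_fV.
transitivity (F 1 * F 6 ^+ 2 * (F 3)^-1 * (F 6)^-1 ^+ 2 * F 2 ^+ k *
  (F 4)^-1 ^+ e).
  by ring.
by rewrite theta_true15 (exprS _ k); ring.
Qed.

(** Replacing f_1 by f_2 Theta'(1,3) / f_4 turns f_4^(-3) into f_4^(-4). *)
Lemma eta_quotient_1_k_0 (k : nat) : eta_quotient [:: 1; k%:Z; 0; -3] =
  rho (n1 ^+ k.+1 * (F 2)^-1 ^+ 4) * theta true 1 3.
Proof.
rewrite eta_quotientE rmorphM /= !rmorphXn /= rmorphV ?qprod_unit //=.
rewrite rho_n1 rho_f2.
rewrite (_ : -3 = - (3%N)%:Z) // expr0z -exprnN -exprVn -!exprnP expr1.
apply: (eq_mul1 (s := F 4 * (F 4)^-1) (t := 1)) => //; first by rewrite mul_fV.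
transitivity (F 1 * F 4 * (F 4)^-1 ^+ 4 * F 2 ^+ k); first by ring.
by rewrite theta_true13 (exprS _ k); ring.
Qed.

Lemma sign_pattern_theta s v z : s = rho v * theta true 1 (2 * z + 1) ->
    (forall n, 0 < coefs (v * theta (odd z) (z + 2) (3 * z + 2)) n) ->
    (forall n, 0 < coefs (v * theta (odd z) (3 * z + 4) z) n) ->
  forall n : nat, [/\ 0 < coefs s (4 * n)%N, coefs s (4 * n + 1)%N < 0,
    coefs s (4 * n + 2)%N < 0 & 0 < coefs s (4 * n + 3)%N].
Proof.
move=> -> p0 p1; apply: sign_pattern p0 p1.
by rewrite theta_split !rmorphM /=; ring.
Qed.

(** * Positivity for the three families *)

(** The shape to which every case is reduced: [s] is positive below q^r, and [t] only has to be
    nonnegative with positive constant term. *)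
Lemma positive_form r m s t u : (0 < r)%N -> (0 < m)%N ->
    ppos (iota 0 r) s -> ppos [:: 0] t -> u = s / qprod true r m * t ->
  forall n, 0 < coefs u n.
Proof.
by move=> r0 m0 s0 t0 ->; apply: positive_mul => //; apply: positive_div.
Qed.

(** Since chi = psi / f_4, the exponents of psi at n = 0, 1, -1 carry over. *)
Lemma ppos_chi : ppos [:: 0; 1; 3] chi.
Proof.
have -> : chi = theta false 1 3 * (F 4)^-1.
  by rewrite theta13 -mulrA mul_fV ?mulr1.
apply: ppos_sub (pposM (@ppos_theta 1 3 [:: Posz 0; Posz 1; Negz 0] _)
  (@ppos_qprodV 4 4 _ _)); by [].
Qed.

Lemma ppos_phi : ppos [:: 0; 1; 4] (theta false 1 1).
Proof. exact: (@ppos_theta 1 1 [:: Posz 0; Posz 1; Posz 2]). Qed.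

Lemma ppos_psi : ppos [:: 0; 1; 3] (theta false 1 3).
Proof. exact: (@ppos_theta 1 3 [:: Posz 0; Posz 1; Negz 0]). Qed.

Lemma ppos_theta0 x y : (0 < x + y)%N -> ppos [:: 0] (theta false x y).
Proof.
move=> xy; apply: ppos_sub (@ppos_theta x y [:: Posz 0] xy).
by rewrite /= !muln0.
Qed.

Lemma pposM0 s t : ppos [:: 0] s -> ppos [:: 0] t -> ppos [:: 0] (s * t).
Proof. by move=> s0 t0; apply: ppos_sub (pposM s0 t0). Qed.

(** The factor of [t] is chi^(k+1) f_2^(k+1-e). By phi = f_2 chi^2 and psi = f_4 chi the five cases
    are chi / f_2, phi / f_2, phi psi / f_4, phi^2 / f_2 and phi^2 psi / f_4. *)
Lemma positive_2_k_0 (k e : nat) t :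
    (k, e) \in [:: (0, 2); (1, 2); (2, 2); (3, 3); (4, 3)] -> ppos [:: 0] t ->
  forall n, 0 < coefs (n1 ^+ k.+1 * (F 2)^-1 ^+ e * t) n.
Proof.
have F2 : F 2 * (F 2)^-1 = 1 by rewrite mul_fV.
have F4 : F 4 * (F 4)^-1 = 1 by rewrite mul_fV.
rewrite !inE => + t0 => /or4P[|||/orP[]] /eqP[-> ->].
- apply: (@positive_form 2 2 chi t) => //; first exact: ppos_sub ppos_chi.
  by apply: (eq_mul1 (s := 1) (t := F 2 * (F 2)^-1)) => //; ring.
- apply: (@positive_form 2 2 (theta false 1 1) t) => //.
    exact: ppos_sub ppos_phi.
  rewrite theta11.
  by apply: (eq_mul1 (s := 1) (t := F 2 * (F 2)^-1)) => //; ring.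
- apply: (@positive_form 4 4 (theta false 1 1 * theta false 1 3) t) => //.
    exact: ppos_sub (pposM ppos_phi ppos_psi).
  rewrite theta11 theta13.
  apply: (eq_mul1 (s := F 4 * (F 4)^-1) (t := (F 2 * (F 2)^-1) ^+ 2)) => //.
    by rewrite F2 expr1n.
  by ring.
- apply: (@positive_form 2 2 (theta false 1 1 ^+ 2) t) => //.
    exact: ppos_sub (pposM ppos_phi ppos_phi).
  rewrite theta11; apply: (eq_mul1 (s := 1) (t := (F 2 * (F 2)^-1) ^+ 2)) => //.
    by rewrite F2 expr1n.
  by ring.
- apply: (@positive_form 4 4 (theta false 1 1 ^+ 2 * theta false 1 3) t) => //.
    exact: ppos_sub (pposM (pposM ppos_phi ppos_phi) ppos_psi).
  rewrite theta11 theta13.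
  apply: (eq_mul1 (s := F 4 * (F 4)^-1) (t := (F 2 * (F 2)^-1) ^+ 3)) => //.
    by rewrite F2 expr1n.
  by ring.
Qed.

(* chi(q) / chi(q^3) *)
Local Notation pi6 := (qprod false 1 6 * qprod false 5 6).

Lemma ppos_pi6 : ppos [:: 0; 1] pi6.
Proof. exact: ppos_sub (pposM (@ppos_qprod 1 6 _ _) (@ppos_qprod 5 6 _ _)). Qed.

Lemma chi_split : chi = pi6 * qprod false 3 6.
Proof. by rewrite (qprod_split3 false 1 (m := 2)) //= mulrAC. Qed.

Lemma ppos_fV j : (0 < j)%N -> ppos [:: 0] (F j)^-1.
Proof. by move=> j0; apply: ppos_qprodV. Qed.

(** For the case k = 0 below: there chi / (-q^3; q^6)^2 = pi6 / (-q^3; q^6) still has a denominator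
    producing negative signs, and Theta(1,2) absorbs it. *)
Lemma theta12 : theta false 1 2 * qprod false 3 6 ^+ 2 * F 12 ^+ 2 * F 2 =
  chi * F 4 * F 6 ^+ 3.
Proof.
have e1 : theta false 1 2 * qprod false 3 3 = qprod false 1 1 * F 3.
  by rewrite (qprod_split3 false 1 (m := 1)) // /theta; ring.
have e2 : qprod false 3 3 = qprod false 3 6 * qprod false 6 6.
  by rewrite (qprod_split2 false 3 (m := 3)).
have e3 : qprod false 1 1 = chi * qprod false 2 2.
  by rewrite (qprod_split2 false 1 (m := 1)).
have e4 : F 3 = qprod true 3 6 * F 6 by rewrite (qprod_split2 true 3 (m := 3)).
have e5 : qprod false 2 2 * F 2 = F 4 by rewrite qprod_sqr.
have e6 : qprod false 6 6 * F 6 = F 12 by rewrite qprod_sqr.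
have e7 : qprod false 3 6 * qprod true 3 6 * F 12 = F 6.
  by rewrite qprod_sqr // [RHS](qprod_split2 true 6 (m := 6)).
transitivity (theta false 1 2 * qprod false 3 3 * qprod false 3 6 *
  F 6 * F 12 * F 2).
  by rewrite e2 -e6; ring.
rewrite e1 e3 e4 -e5.
transitivity (chi * qprod false 2 2 * F 2 * F 6 ^+ 2 *
  (qprod false 3 6 * qprod true 3 6 * F 12)); first by ring.
by rewrite e7; ring.
Qed.

(** For k > 0, two of the factors chi cancel (-q^3; q^6)^2 and leave [pi6 ^+ 2]. The cases are then
    pi6^2 / (f_2 f_6^2), and chi, phi, phi chi times pi6^2 / f_6^2. *)
Lemma positive_1_k_m1 (k e : nat) t :
    (k, e) \in [:: (0, 3); (1, 3); (2, 3); (3, 3); (4, 4)] -> ppos [:: 0] t ->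
  forall n, 0 < coefs (n1 ^+ k.+1 * n3^-1 ^+ 2 * (F 2)^-1 ^+ e * t) n.
Proof.
have F2 : F 2 * (F 2)^-1 = 1 by rewrite mul_fV.
have F4 : F 4 * (F 4)^-1 = 1 by rewrite mul_fV.
have F6 : F 6 * (F 6)^-1 = 1 by rewrite mul_fV.
have c3 : qprod false 3 6 * (qprod false 3 6)^-1 = 1.
  by rewrite divrr // qprod_unit.
have n3V : n3^-1 = (F 6)^-1 * (qprod false 3 6)^-1.
  by rewrite invrM ?qprod_unit.
have F6V := ppos_fV (isT : 0 < 6)%N.
have pp2 := pposM ppos_pi6 ppos_pi6.
rewrite !inE n3V => + t0 => /or4P[|||/orP[]] /eqP[-> ->].
- have p6 : ppos [:: 0] (qprod false 6 6) by apply: ppos_sub (ppos_qprod _ _).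
  apply: (@positive_form 2 2 (theta false 1 2) ((F 4)^-1 * (F 6)^-1 ^+ 3 *
    qprod false 6 6 ^+ 2 * t)) => //.
  + exact: (@ppos_theta 1 2 [:: Posz 0; Posz 1]).
  + apply: (pposM0 _ t0); apply: pposM0; first apply: pposM0.
    * exact: ppos_fV.
    * exact: (pposM0 F6V (pposM0 F6V F6V)).
    * exact: (pposM0 p6 p6).
  apply: (eq_mul1 (s := (F 4 * (F 4)^-1) * (F 6 * (F 6)^-1) ^+ 3)
    (t := (F 2 * (F 2)^-1) ^+ 2 * (F 6 * (F 6)^-1) ^+ 2 *
      (qprod false 3 6 * (qprod false 3 6)^-1) ^+ 2)).
  + by rewrite F4 F6 !expr1n !mul1r.
  + by rewrite F2 F6 c3 !expr1n !mul1r.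
  transitivity (chi * F 4 * F 6 ^+ 3 * (F 2 * (F 4)^-1 * (F 6)^-1 ^+ 5 *
    (F 2)^-1 ^+ 3 * (qprod false 3 6)^-1 ^+ 2 * t)); first by ring.
  have e12 : F 12 = qprod false 6 6 * F 6 by rewrite qprod_sqr.
  by rewrite -theta12 e12; ring.
- apply: (@positive_form 2 2 pi6 (pi6 * (F 6)^-1 ^+ 2 * t)) => //.
  + exact: ppos_sub ppos_pi6.
  + apply: (pposM0 _ t0); apply: pposM0; last exact: (pposM0 F6V F6V).
    exact: ppos_sub ppos_pi6.
  apply: (eq_mul1 (s := 1) (t := (F 2 * (F 2)^-1) ^+ 2 *
    (qprod false 3 6 * (qprod false 3 6)^-1) ^+ 2)) => //.
    by rewrite F2 c3 !expr1n !mul1r.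
  by rewrite chi_split; ring.
- apply: (@positive_form 6 6 (chi * pi6 ^+ 2) ((F 6)^-1 * t)) => //.
  + exact: ppos_sub (pposM ppos_chi pp2).
  + exact: pposM0 F6V t0.
  apply: (eq_mul1 (s := 1) (t := (F 2 * (F 2)^-1) ^+ 3 *
    (qprod false 3 6 * (qprod false 3 6)^-1) ^+ 2)) => //.
    by rewrite F2 c3 !expr1n !mul1r.
  by rewrite chi_split; ring.
- apply: (@positive_form 6 6 (theta false 1 1 * pi6 ^+ 2) ((F 6)^-1 * t)) => //.
  + exact: ppos_sub (pposM ppos_phi pp2).
  + exact: pposM0 F6V t0.
  rewrite theta11; apply: (eq_mul1 (s := 1) (t := (F 2 * (F 2)^-1) ^+ 3 *
    (qprod false 3 6 * (qprod false 3 6)^-1) ^+ 2)) => //.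
    by rewrite F2 c3 !expr1n !mul1r.
  by rewrite chi_split; ring.
- apply: (@positive_form 6 6 (theta false 1 1 * chi * pi6 ^+ 2)
    ((F 6)^-1 * t)) => //.
  + exact: ppos_sub (pposM (pposM ppos_phi ppos_chi) pp2).
  + exact: pposM0 F6V t0.
  rewrite theta11; apply: (eq_mul1 (s := 1) (t := (F 2 * (F 2)^-1) ^+ 4 *
    (qprod false 3 6 * (qprod false 3 6)^-1) ^+ 2)) => //.
    by rewrite F2 c3 !expr1n !mul1r.
  by rewrite chi_split; ring.
Qed.

Local Notation H a b := ((qprod true a 8)^-1 *
  ((qprod true b 8)^-1 * (qprod true 4 8)^-1)).

(** The odd residues modulo 8 make up (q; q^2), and chi (q; q^2) = (q^2; q^4) = f_2 / f_4. *)
Lemma chi_qprod8 : chi * (qprod true 1 8 * qprod true 7 8 * (qprod true 3 8 *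
  qprod true 5 8)) * F 4 = F 2.
Proof.
have e : qprod true 1 8 * qprod true 7 8 * (qprod true 3 8 * qprod true 5 8) =
    qprod true 1 2.
  rewrite (qprod_split2 true 1 (m := 2)) // (qprod_split2 true 1 (m := 4)) //.
  by rewrite (qprod_split2 true 3 (m := 4)) //=; ring.
by rewrite e qprod_sqr // [RHS](qprod_split2 true 2 (m := 2)).
Qed.

(** The theta factor alternates, so one chi is spent on it: chi Theta'(c,d) = f_2 H(a,b). What
    remains is chi^k f_2^(k-2) H(a,b). Keeping a, b, c, d general covers both halves of the
    splitting. *)
Lemma positive_1_k_0 (k a b c d : nat) :
    (k \in [:: 1; 2; 3; 4])%N -> (0 < a <= 3)%N -> (0 < b)%N -> (c + d = 8)%N ->
    chi * (qprod true a 8 * qprod true b 8 * (qprod true c 8 * qprod true d 8))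
      * F 4 = F 2 ->
  forall n, 0 < coefs (n1 ^+ k.+1 * (F 2)^-1 ^+ 4 * theta true c d) n.
Proof.
move=> + /andP[a0 a3] b0 cd e.
have F2 : F 2 * (F 2)^-1 = 1 by rewrite mul_fV.
have F4 : F 4 * (F 4)^-1 = 1 by rewrite mul_fV.
have aV : qprod true a 8 * (qprod true a 8)^-1 = 1.
  by rewrite divrr // qprod_unit.
have bV : qprod true b 8 * (qprod true b 8)^-1 = 1.
  by rewrite divrr // qprod_unit.
have V4 : qprod true 4 8 * (qprod true 4 8)^-1 = 1.
  by rewrite divrr // qprod_unit.
have chi_theta : chi * theta true c d = F 2 * H a b.
  rewrite /theta cd.
  apply: (eq_mul1 (t := 1) (s := (qprod true a 8 * (qprod true a 8)^-1) *
    ((qprod true b 8 * (qprod true b 8)^-1) *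
    (qprod true 4 8 * (qprod true 4 8)^-1)))) => //.
    by rewrite aV bV V4 !mulr1.
  (* Here f_4 = P(4, 8) f_8, and f_8 is the last factor of the theta product. *)
  rewrite -{1}e (qprod_split2 true 4 (m := 4)) //.
  by ring.
have bH : ppos [:: 0] ((qprod true b 8)^-1 * (qprod true 4 8)^-1).
  by apply: pposM0; apply: ppos_qprodV.
have aH : ppos [:: 0] (qprod true a 8)^-1 by apply: ppos_qprodV.
have vE : n1 ^+ k.+1 * (F 2)^-1 ^+ 4 * theta true c d =
    chi ^+ k * F 2 ^+ k.+2 * (F 2)^-1 ^+ 4 * H a b.
  rewrite exprMn 2!exprS.
  transitivity (chi ^+ k * F 2 ^+ k * F 2 * (F 2)^-1 ^+ 4 *
    (chi * theta true c d)); first by ring.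
  by rewrite chi_theta !exprS; ring.
rewrite vE !inE => /or4P[] /eqP->.
- apply: (@positive_form 2 2 chi (H a b)) => //; first exact: ppos_sub ppos_chi.
    exact: pposM0.
  apply: (eq_mul1 (s := 1) (t := (F 2 * (F 2)^-1) ^+ 3)) => //.
    by rewrite F2 expr1n.
  by ring.
- apply: (@positive_form 2 2 (theta false 1 1) (H a b)) => //.
  + exact: ppos_sub ppos_phi.
  + exact: pposM0.
  rewrite theta11.
  apply: (eq_mul1 (s := F 2 * (F 2)^-1) (t := (F 2 * (F 2)^-1) ^+ 4)) => //.
    by rewrite F2 expr1n.
  by ring.
- apply: (@positive_form 4 4 (theta false 1 1 * theta false 1 3) (H a b)) => //.
  + exact: ppos_sub (pposM ppos_phi ppos_psi).
  + exact: pposM0.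
  rewrite theta11 theta13.
  apply: (eq_mul1 (s := F 4 * (F 4)^-1) (t := (F 2 * (F 2)^-1) ^+ 4)) => //.
    by rewrite F2 expr1n.
  by ring.
(* For k = 4 the product is phi^2 H(a,b), and 1 / P(a, 8) is taken from H. As 3 is not a sum of two
   squares, phi^2 is positive only below q^3, hence the bound a <= 3. *)
- apply: (@positive_form a 8 (theta false 1 1 ^+ 2)
    ((qprod true b 8)^-1 * (qprod true 4 8)^-1)) => //.
    apply: ppos_sub (pposM ppos_phi ppos_phi).
    by case: a a0 a3 {e aV chi_theta aH vE} => [|[|[|[|]]]].
  rewrite theta11; apply: (eq_mul1 (s := 1) (t := (F 2 * (F 2)^-1) ^+ 4)) => //.
    by rewrite F2 expr1n.
  by ring.
Qed.

(** * The fourteen quadruples, by family *)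

Theorem theorem4p4 (t1 t2 t3 t4 : int) :
  (t1, t2, t3, t4) \in S6 ->
  forall n : nat,
    [/\ 0 < a_ [:: t1; t2; t3; t4] (4 * n)%N,
        a_ [:: t1; t2; t3; t4] (4 * n + 1)%N < 0,
        a_ [:: t1; t2; t3; t4] (4 * n + 2)%N < 0
      & 0 < a_ [:: t1; t2; t3; t4] (4 * n + 3)%N].
Proof.
move=> t_S6 n; rewrite /a_; move: n.
(* The values z = 0, 2, 1 in [sA], [sB], [sC] give Theta'(1,1), Theta'(1,5), Theta'(1,3). For even z
   both halves have nonnegative terms and serve directly as [t]; for z = 1 they are Theta'(3,5) and
   Theta'(7,1). *)
have sA k e ke := @sign_pattern_theta _ _ 0 (eta_quotient_2_k_0 k e)
  (positive_2_k_0 ke (ppos_theta0 (isT : 0 < 2 + 2)%N))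
  (positive_2_k_0 ke (ppos_theta0 (isT : 0 < 4 + 0)%N)).
have sB k e ke := @sign_pattern_theta _ _ 2 (eta_quotient_1_k_m1 k e)
  (positive_1_k_m1 ke (ppos_theta0 (isT : 0 < 4 + 8)%N))
  (positive_1_k_m1 ke (ppos_theta0 (isT : 0 < 10 + 2)%N)).
have chi_qprod8' : chi * (qprod true 3 8 * qprod true 5 8 *
    (qprod true 7 8 * qprod true 1 8)) * F 4 = F 2.
  by rewrite -[RHS]chi_qprod8; ring.
have sC k ke := @sign_pattern_theta _ _ 1 (eta_quotient_1_k_0 k)
  (@positive_1_k_0 k 1 7 3 5 ke isT isT erefl chi_qprod8)
  (@positive_1_k_0 k 3 5 7 1 ke isT isT erefl chi_qprod8').
move: t_S6; rewrite !inE.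
case/orP=> [/eqP[-> -> -> ->]|]; first exact: (sB 0%N 3%N isT).
case/orP=> [/eqP[-> -> -> ->]|]; first exact: (sB 1%N 3%N isT).
case/orP=> [/eqP[-> -> -> ->]|]; first exact: (sB 2%N 3%N isT).
case/orP=> [/eqP[-> -> -> ->]|]; first exact: (sB 3%N 3%N isT).
case/orP=> [/eqP[-> -> -> ->]|]; first exact: (sB 4%N 4%N isT).
case/orP=> [/eqP[-> -> -> ->]|]; first exact: (sA 0%N 2%N isT).
case/orP=> [/eqP[-> -> -> ->]|]; first exact: (sA 1%N 2%N isT).
case/orP=> [/eqP[-> -> -> ->]|]; first exact: (sA 2%N 2%N isT).
case/orP=> [/eqP[-> -> -> ->]|]; first exact: (sA 3%N 3%N isT).
case/orP=> [/eqP[-> -> -> ->]|]; first exact: (sA 4%N 3%N isT).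
case/orP=> [/eqP[-> -> -> ->]|]; first exact: (sC 1%N isT).
case/orP=> [/eqP[-> -> -> ->]|]; first exact: (sC 2%N isT).
case/orP=> [/eqP[-> -> -> ->]|]; first exact: (sC 3%N isT).
by case/eqP=> -> -> -> ->; exact: (sC 4%N isT).
Qed.
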